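(* Let $(\mathcal{H},d)$ be a Hadamard space and $(\mathcal{H}^n,d^n)_{n\in\mathbb{N}}$ a sequence of Hadamard spaces, and suppose an asymptotic relation between $(\mathcal{H}^n)$ and $\mathcal{H}$ is given. Let $f:\mathcal{H}\to(-\infty,\infty]$ and $f^n:\mathcal{H}^n\to(-\infty,\infty]$, $n\in\mathbb{N}$, be proper lower semicontinuous convex functions. Let $J_\lambda:\mathcal{H}\to\mathcal{H}$ and $J^n_\lambda:\mathcal{H}^n\to\mathcal{H}^n$, $\lambda>0$, be the corresponding resolvents, and let $S_t:\overline{\operatorname{dom}}\,f\to\operatorname{dom}f$ and $S^n_t:\overline{\operatorname{dom}}\,f^n\to\operatorname{dom}f^n$, $t>0$, be the corresponding gradient flow semigroups. Assume that for every $x\in\overline{\operatorname{dom}}\,f$, every sequence $x_n\in\mathcal{H}^n$ with $x_n\to x$, and every $\lambda>0$, $$\lim_{n\to\infty}J^n_\lambda x_n=J_\lambda x.$$ Then $$\lim_{n\to\infty}S^n_t x_n=S_t x$$ for every $x\in\overline{\operatorname{dom}}\,f$, every sequence $x_n\in\overline{\operatorname{dom}}\,f^n\subset\mathcal{H}^n$ with $x_n\to x$, and every $t>0$.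
   Context: A Hadamard space is a complete geodesic metric space $(\mathcal{H},d)$ such that $d(x,\gamma(t))^2\le(1-t)d(x,\gamma(0))^2+t\,d(x,\gamma(1))^2-t(1-t)d(\gamma(0),\gamma(1))^2$ for every $x\in\mathcal{H}$, every (constant-speed) geodesic $\gamma:[0,1]\to\mathcal{H}$ and every $t\in[0,1]$. A function is convex if its composition with every geodesic $\gamma:[0,1]\to\mathcal{H}$ is convex; it is proper if it is not identically $\infty$. Write $\operatorname{dom}f=\{x:f(x)<\infty\}$ and $\overline{\operatorname{dom}}\,f$ for its closure. For a proper convex lower semicontinuous function $f$ on a Hadamard space $(\mathcal{H},d)$ and $\lambda>0$, the resolvent is $J_\lambda(x)=\arg\min_{y\in\mathcal{H}}\left[f(y)+\frac1{2\lambda}d(x,y)^2\right]$, $x\in\mathcal{H}$ (the minimizer exists and is unique). The gradient flow semigroup of $f$ is $S_t(x)=\lim_{k\to\infty}\left(J_{t/k}\right)^{(k)}(x)$ for $x\in\overline{\operatorname{dom}}\,f$, where $F^{(k)}$ denotes the $k$-fold composition of a map $F$ with itself; this limit exists, and each $S_t$ is nonexpansive. For $f^n$ on $(\mathcal{H}^n,d^n)$ the same definitions are used with $d^n$. Asymptotic relation: given a metric space $(X,d)$ and metric spaces $(X^n,d^n)_{n\in\mathbb{N}}$, let $\mathcal{X}=\left(\bigsqcup_{n}X^n\right)\sqcup X$ be the disjoint union. A topology on $\mathcal{X}$ is an asymptotic relation between $(X^n)$ and $X$ if: (A1) all $X^n$ and $X$ are closed in $\mathcal{X}$, and the topology of $\mathcal{X}$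 restricted to each $X^n$ and to $X$ is its original topology; (A2) for every $x\in X$ there is a sequence $x^n\in X^n$ converging to $x$ in $\mathcal{X}$; (A3) if $x^n\in X^n$ converges to $x\in X$ and $y^n\in X^n$ converges to $y\in X$ in $\mathcal{X}$, then $d^n(x^n,y^n)\to d(x,y)$; (A4) if $x^n\in X^n$ converges to $x\in X$ in $\mathcal{X}$ and $y^n\in X^n$ satisfies $d^n(x^n,y^n)\to0$, then $y^n$ converges to $x$ in $\mathcal{X}$. For $x^n\in X^n$ and $x\in X$, $x^n\to x$ means convergence in $\mathcal{X}$; all limits in the claim are in this sense. *)

(* Defs.v *)
From HB Require Import structures.
From mathcomp Require Import all_boot all_order all_algebra.
From mathcomp Require Import all_classical all_reals all_analysis.

Set Implicit Arguments.
Unset Strict Implicit.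
Unset Printing Implicit Defensive.

Import Order.TTheory GRing.Theory Num.Theory.
Import numFieldNormedType.Exports.

Local Open Scope classical_set_scope.
Local Open Scope ring_scope.

Section hadamard.
Context {R : realType} (X : metricType R).

(* Geodesics are total functions on R; only their values on [0, 1] matter. *)
Definition geodesic (g : R -> X) : Prop :=
  forall s t, 0 <= s <= 1 -> 0 <= t <= 1 ->
    mdist (g s) (g t) = `|s - t| * mdist (g 0) (g 1).

Definition geodesic_space : Prop :=
  forall x y : X, exists g : R -> X, [/\ geodesic g, g 0 = x & g 1 = y].

(* The axiom of the library's completeType, which would also require a
   distinguished point. *)
Definition complete_space : Prop :=
  forall F : set_system X, ProperFilter F -> cauchy F -> exists l : X, F --> l.

Definition hadamard_space : Prop :=
  [/\ complete_space, geodesic_space &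
      forall (x : X) (g : R -> X) (t : R), geodesic g -> 0 <= t <= 1 ->
        mdist x (g t) ^+ 2 <=
          (1 - t) * mdist x (g 0) ^+ 2 + t * mdist x (g 1) ^+ 2
          - t * (1 - t) * mdist (g 0) (g 1) ^+ 2].

End hadamard.

Section functions.
Context {R : realType} {X : metricType R}.
Implicit Type f : X -> \bar R.
Local Open Scope ereal_scope.

Definition dom f : set X := [set x | f x < +oo].

Definition proper_fun f : Prop := exists x, f x != +oo.

(* For functions that do not take the value -oo: the right-hand side is then
   well defined, with the convention 0 * +oo = 0. *)
Definition geodesically_convex f : Prop :=
  forall g : R -> X, geodesic g ->
  forall s t a : R, (0 <= s <= 1)%R -> (0 <= t <= 1)%R -> (0 <= a <= 1)%R ->
    f (g ((1 - a) * s + a * t)%R) <= (1 - a)%:E * f (g s) + a%:E * f (g t).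

Definition argmin f : set X := [set y | forall z, f y <= f z].

(* The value of xget is the minimizer, resp. the limit, whenever it exists; the
   default value x only serves to make the operators total. *)
Definition resolvent f (lambda : R) (x : X) : X :=
  xget x (argmin (fun y => f y + ((2 * lambda)^-1 * mdist x y ^+ 2)%:E)).

Definition gradient_flow f (t : R) (x : X) : X :=
  xget x [set l | (fun k : nat => iter k (resolvent f (t / k%:R)) x) @ \oo --> l].

End functions.

Definition dunion (Xn : nat -> Type) (X : Type) : Type := ({n & Xn n} + X)%type.

Definition topology_on (T : Type) : Type := Topological.axioms_ T.

Definition topologize (T : Type) (tau : topology_on T) : topologicalType :=
  Topological.Pack tau.

Section asymptotic.
Context {R : realType} {Xn : nat -> metricType R} {X : metricType R}.
Variable tau : topology_on (dunion Xn X).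

Let XX : topologicalType := topologize tau.

Definition in_seq (n : nat) (x : Xn n) : XX := inl (existT (fun n => Xn n) n x).

Definition in_lim (x : X) : XX := inr x.

Definition asym_cvg (u : forall n, Xn n) (x : X) : Prop :=
  (fun n => in_seq (u n)) @ \oo --> in_lim x.

(* i is injective in all uses below: Y carries the topology induced by XX. *)
Definition closed_subspace (Y : topologicalType) (i : Y -> XX) : Prop :=
  closed (range i) /\
  forall U : set Y, open U <-> exists2 V : set XX, open V & i @^-1` V = U.

Record asymptotic_relation : Prop := AsymptoticRelation {
  asym_closed_seq : forall n, closed_subspace (@in_seq n) ;
  asym_closed_lim : closed_subspace in_lim ;
  asym_approx : forall x : X, exists u : forall n, Xn n, asym_cvg u x ;
  asym_dist : forall (u v : forall n, Xn n) (x y : X),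
    asym_cvg u x -> asym_cvg v y ->
    (fun n => mdist (u n) (v n)) @ \oo --> mdist x y ;
  asym_near : forall (u v : forall n, Xn n) (x : X),
    asym_cvg u x -> (fun n => mdist (u n) (v n)) @ \oo --> (0 : R) ->
    asym_cvg v x
}.

End asymptotic.

(* Main.v *)
(* The implicit Euler scheme [(J_{t/k})^(k) x] approximates [S_t x] at a rate that
   only depends on [d(x, J_nu x)]: by Crandall and Liggett's argument, based on
   the resolvent identity and the nonexpansiveness of resolvents,
   [d((J_{t/k})^(k) x, S_t x) <= 2 d(x, J_nu x) + d(x, J_nu x) / nu * t / sqrt k]
   as soon as [t / k <= nu].  Since [J^n_nu u_n -> J_nu x], this estimate is
   uniform in [n], and the first term is small for small [nu] because [x] is in
   the closure of the domain.  For fixed [k] the scheme converges along the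
   asymptotic relation, by iterating the convergence of resolvents. *)

Require Import Defs.
From mathcomp Require Import all_boot all_order all_algebra.
From mathcomp Require Import all_classical all_reals all_analysis.
From mathcomp Require Import ring lra.

Import Order.TTheory GRing.Theory Num.Theory.
Import numFieldNormedType.Exports.

Local Open Scope classical_set_scope.
Local Open Scope ring_scope.

(** * Comparison inequalities and completeness in Hadamard spaces *)

Section hadamard_geometry.
Context {R : realType} {X : metricType R}.
Implicit Types (f : X -> \bar R) (x y z w p q : X) (a : R).

(** One point of one geodesic carries the metric, curvature and convexity bounds together, so later
    proofs need not handle geodesics. *)
Lemma geodesic_comparison x y a : hadamard_space X -> 0 <= a <= 1 ->
  exists z, [/\ mdist x z = a * mdist x y, mdist z y = (1 - a) * mdist x y,
    forall w, mdist w z ^+ 2 <= (1 - a) * mdist w x ^+ 2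
      + a * mdist w y ^+ 2 - a * (1 - a) * mdist x y ^+ 2 &
    forall f, geodesically_convex f ->
      (f z <= (1 - a)%:E * f x + a%:E * f y)%E].
Proof.
move=> [_ geo cat0] a01; have [g [gg g0 g1]] := geo x y.
have /andP[a0 a1] := a01.
have h0 : 0 <= (0 : R) <= 1 by rewrite lexx ler01.
have h1 : 0 <= (1 : R) <= 1 by rewrite ler01 lexx.
exists (g a); split.
- by have := gg _ _ h0 a01; rewrite g0 g1 sub0r normrN ger0_norm.
- have := gg _ _ a01 h1; rewrite g0 g1 distrC ger0_norm// subr_ge0//.
- by move=> w; have := cat0 w g a gg a01; rewrite g0 g1.
- move=> f fc; have := fc g gg 0 1 a h0 h1 a01.
  by rewrite mulr0 add0r mulr1 g0 g1.
Qed.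

(* Berg and Nikolaev's quasilinear Cauchy-Schwarz inequality: compare [y] and
   [p] with the point [z] dividing the diagonal [x q] in the ratio
   [mdist x y : mdist p q], using [(a + b)^2 <= a^2 / t + b^2 / (1 - t)]. *)
Lemma mdist_quadrilateral x y p q : hadamard_space X ->
  mdist x q ^+ 2 + mdist y p ^+ 2 <=
  mdist x p ^+ 2 + mdist y q ^+ 2 + 2 * mdist x y * mdist p q.
Proof.
move=> hX.
have [->|xy] := eqVneq x y; first by rewrite mdistxx mulr0 mul0r addr0 addrC.
have [->|pq] := eqVneq p q; first by rewrite mdistxx mulr0 addr0.
move: xy pq; rewrite -!mdist_gt0; set u := mdist x y; set v := mdist p q => u0 v0.
have s0 : 0 < u + v by rewrite addr_gt0.
pose t := u / (u + v).
have tE : 1 - t = v / (u + v) by rewrite /t; field; rewrite lt0r_neq0.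
have t01 : 0 <= t <= 1.
  by rewrite -(subr_ge0 t 1) tE /t; apply/andP; split; rewrite divr_ge0 ?ltW.
have [z [_ _ cz _]] := geodesic_comparison x q t hX t01.
have := cz y; have := cz p.
have := metric_triangle y z p.
rewrite (metric_sym z p) (metric_sym p x) (metric_sym y x) -/u -/v.
have A0 := mdist_ge0 y z; have B0 := mdist_ge0 p z; have C0 := mdist_ge0 y p.
move: A0 B0 C0.
set A := mdist y z; set B := mdist p z; set C := mdist y p; set D := mdist x q.
set E := mdist x p; set F := mdist y q.
move=> A0 B0 C0 CAB hB hA.
have hC : C ^+ 2 <= (A + B) ^+ 2 by rewrite ler_pXn2r// nnegrE addr_ge0.
have hAB : (A + B) ^+ 2 <= A ^+ 2 * ((u + v) / u) + B ^+ 2 * ((u + v) / v).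
  rewrite -subr_ge0.
  have -> : A ^+ 2 * ((u + v) / u) + B ^+ 2 * ((u + v) / v) - (A + B) ^+ 2
    = (A * v - B * u) ^+ 2 / (u * v).
    by field; rewrite !lt0r_neq0.
  by rewrite divr_ge0 ?sqr_ge0// mulr_ge0// ltW.
have hA' : A ^+ 2 * ((u + v) / u) <= v * u + F ^+ 2 - v / (u + v) * D ^+ 2.
  have -> : v * u + F ^+ 2 - v / (u + v) * D ^+ 2
     = ((1 - t) * u ^+ 2 + t * F ^+ 2 - t * (1 - t) * D ^+ 2) * ((u + v) / u).
    by rewrite tE /t; field; rewrite !lt0r_neq0.
  by rewrite ler_wpM2r// divr_ge0 ?ltW.
have hB' : B ^+ 2 * ((u + v) / v) <= E ^+ 2 + u * v - u / (u + v) * D ^+ 2.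
  have -> : E ^+ 2 + u * v - u / (u + v) * D ^+ 2
     = ((1 - t) * E ^+ 2 + t * v ^+ 2 - t * (1 - t) * D ^+ 2) * ((u + v) / v).
    by rewrite tE /t; field; rewrite !lt0r_neq0.
  by rewrite ler_wpM2r// divr_ge0 ?ltW.
have hD : v / (u + v) * D ^+ 2 + u / (u + v) * D ^+ 2 = D ^+ 2.
  by field; rewrite lt0r_neq0.
lra.
Qed.

Lemma mdist_cvg x (u : nat -> X) l : u @ \oo --> l ->
  (fun k => mdist x (u k)) @ \oo --> mdist x l.
Proof.
move=> /metricType_numDomainType.cvgrPdist_lt ul; apply/cvgrPdist_lt => e e0; near=> k.
have h : mdist l (u k) < e by near: k; exact: ul.
have := metric_triangle x l (u k); have := metric_triangle x (u k) l.
rewrite (metric_sym (u k) l) ltr_norml => *; apply/andP; split; lra.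
Unshelve. all: by end_near. Qed.

Lemma cauchy_seq_cvg (u : nat -> X) : hadamard_space X ->
  (forall e : R, 0 < e -> exists N, forall i j, (N <= i)%N -> (i <= j)%N ->
    mdist (u i) (u j) < e) ->
  exists l : X, u @ \oo --> l.
Proof.
move=> [cX _ _] uc; apply: cX.
apply: cauchy_exP => e e0; have [N hN] := uc _ e0.
exists (u N); exists N => // k /= Nk; rewrite ballEmdist/=; exact: hN.
Qed.

End hadamard_geometry.

(** * Convex functions: lower bounds and minimizers of the regularized objective *)

Section resolvent_theory.
Context {R : realType} {X : metricType R} {f : X -> \bar R}.
Hypotheses (hX : hadamard_space X) (f_gtNy : forall x, (-oo < f x)%E).
Hypotheses (f_proper : proper_fun f) (f_lsc : lower_semicontinuous f).
Hypothesis f_convex : geodesically_convex f.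
Implicit Types (x y z w p q : X) (a c lambda mu nu L t : R).

(** Real values make inequalities accessible to [lra]; [fine] sends [+oo] to 0, so [F] is meaningful
    on [dom f] only. *)
Let F x : R := fine (f x).

Lemma dom_fineE x : dom f x -> f x = (F x)%:E.
Proof.
by move=> fx; rewrite /F fineK// fin_numElt f_gtNy.
Qed.

Lemma dom_EFin x a : (f x <= a%:E)%E -> dom f x /\ F x <= a.
Proof.
move=> fxa; have fx : dom f x by rewrite /dom/= (le_lt_trans fxa)// ltry.
by split=> //; rewrite -lee_fin -dom_fineE.
Qed.

Lemma dom_segment {x y} a : dom f x -> dom f y -> 0 <= a <= 1 ->
  exists z, [/\ mdist x z = a * mdist x y, dom f z,
    F z <= (1 - a) * F x + a * F y &
    forall w, mdist w z ^+ 2 <= (1 - a) * mdist w x ^+ 2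
      + a * mdist w y ^+ 2 - a * (1 - a) * mdist x y ^+ 2].
Proof.
move=> fx fy a01; have [z [xz _ cz fz]] := geodesic_comparison x y a hX a01.
have := fz f f_convex; rewrite (dom_fineE _ fx) (dom_fineE _ fy).
rewrite -!EFinM -EFinD => /dom_EFin[dz Fz].
by exists z; split.
Qed.

(* Near [x] this is semicontinuity; far from [x], convexity along the geodesic
   to [y] would otherwise force a too small value near [x]. *)
Lemma convex_lower_bound {x} : dom f x ->
  exists2 B, 0 <= B & forall y, dom f y -> F x - 1 - B * mdist x y <= F y.
Proof.
move=> fx.
have [|V /nbhs_ballP[/= r r0 rV] Vf] := f_lsc x (F x - 1).
  by rewrite (dom_fineE _ fx) lte_fin; lra.
have Fr z : dom f z -> mdist x z < r -> F x - 1 < F z.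
  move=> fz xz; rewrite -lte_fin -dom_fineE//; apply: Vf; apply: rV.
  by rewrite ballEmdist.
exists (2 / r); first by rewrite divr_ge0// ltW.
move=> y fy; have D0 := mdist_ge0 x y.
have [yr|ry] := ltP (mdist x y) r.
  have := Fr y fy yr; have nn : 0 <= 2 / r * mdist x y.
    by rewrite mulr_ge0// divr_ge0// ltW.
  lra.
have Dgt0 : 0 < mdist x y by exact: lt_le_trans ry.
(* This ratio puts [z] at distance [r / 2] from [x], where semicontinuity controls [F]. *)
pose a := r / (2 * mdist x y).
have a0 : 0 < a by rewrite divr_gt0// mulr_gt0.
have a1 : a <= 1 by rewrite ler_pdivrMr ?mulr_gt0//; lra.
have [|z [xz fz Fz _]] := dom_segment a fx fy; first by rewrite ltW.
have : F x - 1 < F z.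
  apply: Fr => //; rewrite xz /a.
  have -> : r / (2 * mdist x y) * mdist x y = r / 2 by field; rewrite lt0r_neq0.
  lra.
move=> h; have h1 : - 1 < a * (F y - F x) by lra.
have -> : 2 / r * mdist x y = a^-1 by rewrite /a; field; rewrite !lt0r_neq0.
have nn : - a^-1 < F y - F x.
  by rewrite -(ltr_pM2l a0) mulrN mulfV// lt0r_neq0.
lra.
Qed.

Lemma dom_nonempty : exists x, dom f x.
Proof. by have [x fx] := f_proper; exists x; rewrite /dom/= ltey. Qed.

(** The quadratic term beats the at most linear decay of [F]; completing the square gives the
    constant. *)
Lemma objective_bounded_below c x : 0 < c ->
  exists m, forall y, dom f y -> m <= F y + c * mdist x y ^+ 2.
Proof.
move=> c0; have [b fb] := dom_nonempty; have [B B0 hB] := convex_lower_bound fb.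
exists (F b - 1 - B * mdist b x - B ^+ 2 / (4 * c)) => y fy.
have := hB y fy; have := metric_triangle b x y.
move=> /(ler_wpM2l B0); rewrite mulrDr.
have : 0 <= c * (mdist x y - B / (2 * c)) ^+ 2 by rewrite mulr_ge0 ?sqr_ge0// ltW.
have -> : c * (mdist x y - B / (2 * c)) ^+ 2 =
    c * mdist x y ^+ 2 - B * mdist x y + B ^+ 2 / (4 * c).
  by field; rewrite lt0r_neq0.
lra.
Qed.

(** Strong convexity of the squared distance makes a minimizing sequence Cauchy, and lower
    semicontinuity makes its limit a minimizer. *)
Lemma objective_minimizer c x : 0 < c ->
  exists2 p, dom f p & forall y, dom f y ->
    F p + c * mdist x p ^+ 2 <= F y + c * mdist x y ^+ 2.
Proof.
move=> c0; pose G y := F y + c * mdist x y ^+ 2.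
pose E : set R := G @` dom f.
have [m0 hm0] := objective_bounded_below c x c0.
have Elb : has_lbound E by exists m0 => _ [y fy <-]; exact: hm0.
have Einf : has_inf E.
  by split=> //; have [b fb] := dom_nonempty; exists (G b); exists b.
pose m := inf E.
have mG y : dom f y -> m <= G y by move=> fy; apply: ge_inf => //; exists y.
have eps0 k : 0 < (k.+1%:R : R)^-1 by rewrite invr_gt0 ltr0n.
have /choice[u hu] : forall k : nat, exists y, dom f y /\ G y < m + k.+1%:R^-1.
  by move=> k; have [_ [y fy <-] ?] := inf_adherent (eps0 k) Einf; exists y.
have epscvg : (fun k => (k.+1%:R : R)^-1) @ \oo --> (0 : R) by exact: cvg_harmonic.
have [p up] : exists p : X, u @ \oo --> p.
  apply: cauchy_seq_cvg => // e e0.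
  have [|N _ hN] := (iffLR (cvgrPdist_lt _ _) epscvg) (c * e ^+ 2 / 4).
    by rewrite divr_gt0// mulr_gt0// exprn_gt0.
  exists N => i j Ni ij.
  have small k : (N <= k)%N -> G (u k) < m + c * e ^+ 2 / 4.
    move=> Nk; have := hN k Nk; have [_] := hu k.
    rewrite /= sub0r normrN gtr0_norm; last exact: eps0.
    by move=> h1 h2; apply: lt_trans h1 _; rewrite ltrD2l.
  have [fi _] := hu i; have [fj _] := hu j.
  (* The midpoint has objective at least [m], while strong convexity gains [c / 4] times the squared
     distance of [u i] and [u j]. *)
  have [|z [_ fz Fz cz]] := dom_segment 2^-1 fi fj; first by lra.
  have := mG z fz; rewrite /G.
  have := cz x; rewrite -(ler_pM2l c0).
  have := small i Ni; have := small j (leq_trans Ni ij); rewrite /G.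
  move=> h1 h2 h3 h4.
  have : c * mdist (u i) (u j) ^+ 2 < c * e ^+ 2 by lra.
  rewrite ltr_pM2l// ltr_pXn2r// nnegrE; [exact: mdist_ge0|exact: ltW].
(* The sequence bounds [F (u k)] from above, by the choice of [u]. *)
have cvgG : (fun k => m + k.+1%:R^-1 - c * mdist x (u k) ^+ 2) @ \oo -->
    m + 0 - c * mdist x p ^+ 2.
  apply: cvgB; first by apply: cvgD => //; exact: cvg_cst.
  apply: cvgM; first exact: cvg_cst.
  by rewrite expr2; under eq_fun do rewrite expr2; apply: cvgM; exact: mdist_cvg.
have [fp Fp] : dom f p /\ F p <= m - c * mdist x p ^+ 2.
  apply: dom_EFin; rewrite leNgt; apply/negP => lt_fp.
  (* A real threshold strictly in between also covers [f p = +oo]. *)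
  have [a [ma afp]] : exists a, m - c * mdist x p ^+ 2 < a /\ (a%:E < f p)%E.
    move: lt_fp; case: (f p) => [r| |]//; rewrite ?lte_fin => h.
      exists ((m - c * mdist x p ^+ 2 + r) / 2); rewrite lte_fin; split; lra.
    exists (m - c * mdist x p ^+ 2 + 1); rewrite ltry; split=> //; lra.
  have [V pV Vf] := f_lsc p a afp.
  have nV : \forall k \near \oo, V (u k) by exact: up.
  have na : \forall k \near \oo, m + k.+1%:R^-1 - c * mdist x (u k) ^+ 2 < a.
    by apply: (cvgr_lt _ cvgG); rewrite addr0.
  near \oo => k.
  have := Vf (u k); have [fk Gk] := hu k.
  have Vk : V (u k) by near: k.
  have ak : m + k.+1%:R^-1 - c * mdist x (u k) ^+ 2 < a by near: k.
  rewrite (dom_fineE _ fk) lte_fin => /(_ Vk); move: Gk ak; rewrite /G.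
  move: (k.+1%:R^-1) => ek; lra.
exists p => // y fy; have := mG y fy; rewrite /G; lra.
Unshelve. all: by end_near. Qed.

Lemma argminP c x p : argmin (fun y => f y + (c * mdist x y ^+ 2)%:E)%E p <->
  dom f p /\ forall y, dom f y ->
    F p + c * mdist x p ^+ 2 <= F y + c * mdist x y ^+ 2.
Proof.
split=> [pmin|[fp pmin] y].
  have [b fb] := dom_nonempty.
  have fp : dom f p.
    have := pmin b; rewrite (dom_fineE _ fb) /dom/= -EFinD.
    by case: (f p) => [r| |]//= _; rewrite ltry.
  split=> // y fy; have := pmin y.
  by rewrite (dom_fineE _ fp) (dom_fineE _ fy) -!EFinD lee_fin.
have [fy|] := ltP (f y) +oo%E.
  by rewrite (dom_fineE _ fp) (dom_fineE _ fy) -!EFinD lee_fin pmin.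
rewrite leye_eq => /eqP ->.
by rewrite addye// leey.
Qed.

(** * Resolvents: variational inequality, nonexpansiveness and resolvent identity *)

Lemma resolvent_minimizer lambda x : 0 < lambda ->
  let p := resolvent f lambda x in
  dom f p /\ forall y, dom f y ->
    F p + (2 * lambda)^-1 * mdist x p ^+ 2 <= F y + (2 * lambda)^-1 * mdist x y ^+ 2.
Proof.
move=> l0; apply/argminP; rewrite /resolvent; apply: xgetPex.
have c0 : 0 < (2 * lambda)^-1 by rewrite invr_gt0 mulr_gt0.
by have [p fp pmin] := objective_minimizer _ x c0; exists p; apply/argminP.
Qed.

Lemma dom_resolvent lambda x : 0 < lambda -> dom f (resolvent f lambda x).
Proof. by move=> /(resolvent_minimizer _ x)[]. Qed.

(* Compare the minimizer with points moving from it towards [y]. *)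
Lemma resolvent_evi lambda x y : 0 < lambda -> dom f y ->
  let p := resolvent f lambda x in
  F p + (2 * lambda)^-1 * mdist x p ^+ 2 + (2 * lambda)^-1 * mdist p y ^+ 2
    <= F y + (2 * lambda)^-1 * mdist x y ^+ 2.
Proof.
move=> l0 fy /=; have [fp pmin] := resolvent_minimizer _ x l0.
set p := resolvent f lambda x in fp pmin *.
have : 0 < (2 * lambda)^-1 by rewrite invr_gt0 mulr_gt0.
set c := (2 * lambda)^-1 in pmin *; move=> c0.
apply/ler_addgt0Pr => e e0.
have D0 : 0 <= c * mdist p y ^+ 2 by rewrite mulr_ge0 ?sqr_ge0// ltW.
(* Small enough that the term of order [t] left by the comparison is at most [e]; adding [e] keeps
   the denominator positive when [p = y]. *)
pose t := e / (c * mdist p y ^+ 2 + e).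
have De0 : 0 < c * mdist p y ^+ 2 + e by rewrite ltr_wpDl.
have t0 : 0 < t by rewrite divr_gt0.
have t1 : t <= 1 by rewrite ler_pdivrMr// mul1r lerDr.
have tD : t * (c * mdist p y ^+ 2) <= e.
  by rewrite mulrAC ler_pdivrMr// ler_pM2l// lerDl ltW.
have [|z [_ fz Fz cz]] := dom_segment t fp fy; first by rewrite ltW.
have := pmin z fz; have := cz x; rewrite -(ler_pM2l c0) => h1 h2.
have : t * (F p + c * mdist x p ^+ 2 + (1 - t) * (c * mdist p y ^+ 2))
    <= t * (F y + c * mdist x y ^+ 2) by lra.
rewrite ler_pM2l//; lra.
Qed.

Lemma resolvent_unique lambda x p : 0 < lambda -> dom f p ->
  (forall y, dom f y -> F p + (2 * lambda)^-1 * mdist x p ^+ 2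
    <= F y + (2 * lambda)^-1 * mdist x y ^+ 2) ->
  resolvent f lambda x = p.
Proof.
move=> l0 fp pmin; have := pmin _ (dom_resolvent _ x l0).
have := resolvent_evi _ x p l0 fp => /= h1 h2.
have c0 : 0 < (2 * lambda)^-1 by rewrite invr_gt0 mulr_gt0.
move: c0 h1 h2; set c := (2 * lambda)^-1 => c0 h1 h2.
have : c * mdist (resolvent f lambda x) p ^+ 2 <= c * 0 by lra.
rewrite ler_pM2l// => h; apply: mdist_positivity; apply/eqP.
by rewrite -sqrf_eq0 eq_le h sqr_ge0.
Qed.

(** Test the variational inequality of each resolvent with the other one and add: the values of [F]
    cancel, and the quadrilateral inequality leaves [mdist p q ^+ 2 <= mdist x y * mdist p q]. *)
Lemma resolvent_nonexpansive lambda x y : 0 < lambda ->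
  mdist (resolvent f lambda x) (resolvent f lambda y) <= mdist x y.
Proof.
move=> l0.
have := resolvent_evi _ x _ l0 (dom_resolvent _ y l0).
have := resolvent_evi _ y _ l0 (dom_resolvent _ x l0).
rewrite /=; set p := resolvent f lambda x; set q := resolvent f lambda y.
rewrite (metric_sym q p).
have c0 : 0 < (2 * lambda)^-1 by rewrite invr_gt0 mulr_gt0.
have := ler_wpM2l (ltW c0) (mdist_quadrilateral x y p q hX).
set c := (2 * lambda)^-1 in c0 *; move=> h1 h2 h3.
have : c * (mdist p q * mdist p q) <= c * (mdist x y * mdist p q) by lra.
rewrite ler_pM2l//.
have := mdist_ge0 p q; rewrite le_eqVlt => /orP[/eqP <- _|pq]; first exact: mdist_ge0.
by rewrite ler_pM2r.
Qed.

(* [mdist x y ^+ 2 <= ((1 - a) D + e) ^+ 2 <= (1 - a) D ^+ 2 + e ^+ 2 / a] with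
   [a = mu / lambda], [D = mdist x p] and [e = mdist w y]. *)
Lemma resolvent_identity lambda mu x w : 0 < mu <= lambda ->
  let p := resolvent f lambda x in
  mdist p w = mu / lambda * mdist p x ->
  mdist w x = (1 - mu / lambda) * mdist p x ->
  resolvent f mu w = p.
Proof.
move=> /andP[m0 ml] p pw wx; have l0 : 0 < lambda by exact: lt_le_trans ml.
have [fp pmin] := resolvent_minimizer _ x l0.
rewrite -/p in fp pmin.
apply: resolvent_unique => // y fy; have := pmin y fy.
have := metric_triangle x w y.
rewrite (metric_sym x w) wx (metric_sym w p) pw (metric_sym p x).
have := mdist_ge0 x p; have := mdist_ge0 x y; have := mdist_ge0 w y.
set D := mdist x p; set E := mdist x y; set e := mdist w y.
set a := mu / lambda => e0 E0 D0 tri h.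
have a0 : 0 < a by rewrite divr_gt0.
have a1 : a <= 1 by rewrite ler_pdivrMr// mul1r.
have cE : (2 * lambda)^-1 = a * (2 * mu)^-1 by rewrite /a; field; rewrite !lt0r_neq0.
have hE : E ^+ 2 <= ((1 - a) * D + e) ^+ 2.
  by rewrite ler_pXn2r// nnegrE addr_ge0// mulr_ge0// subr_ge0.
have sq : a * ((1 - a) * D + e) ^+ 2 <= a * (1 - a) * D ^+ 2 + e ^+ 2.
  rewrite -subr_ge0.
  have -> : a * (1 - a) * D ^+ 2 + e ^+ 2 - a * ((1 - a) * D + e) ^+ 2 =
    (1 - a) * (a * D - e) ^+ 2 by ring.
  by rewrite mulr_ge0 ?sqr_ge0// subr_ge0.
have aE : a * E ^+ 2 <= a * (1 - a) * D ^+ 2 + e ^+ 2.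
  by apply: le_trans sq; rewrite ler_pM2l.
have c0 : 0 < (2 * mu)^-1 by rewrite invr_gt0 mulr_gt0.
move: h; rewrite cE; move: aE; rewrite -(ler_pM2l c0); lra.
Qed.

(* Crandall and Liggett: the resolvent identity gives
   [a i.+1 j.+1 <= mu / lambda * a i j + (1 - mu / lambda) * a i j.+1] for
   [a i j] the left-hand side, a recursion which the right-hand side solves. *)
Lemma iter_resolvent_dist lambda mu L z i j : 0 < mu <= lambda ->
  mdist z (resolvent f mu z) <= L * mu ->
  mdist z (resolvent f lambda z) <= L * lambda ->
  mdist (iter i (resolvent f mu) z) (iter j (resolvent f lambda) z) ^+ 2 <=
  L ^+ 2 * ((i%:R * mu - j%:R * lambda) ^+ 2 + i%:R * mu * (lambda - mu)).
Proof.
move=> /andP[m0 ml] zm zl; have l0 : 0 < lambda by exact: lt_le_trans ml.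
(* By nonexpansiveness no later step is longer than the first. *)
have step nu k : 0 < nu -> mdist z (resolvent f nu z) <= L * nu ->
    mdist z (iter k (resolvent f nu) z) <= L * (k%:R * nu).
  move=> n0 zn; elim: k => [|k IH]; first by rewrite mdistxx mul0r mulr0.
  rewrite iterS; apply: le_trans (metric_triangle _ (resolvent f nu z) _) _.
  have := resolvent_nonexpansive _ z (iter k (resolvent f nu) z) n0.
  rewrite -natr1; lra.
elim: i j => [|i IH] j.
  rewrite !mul0r addr0 sub0r sqrrN -exprMn ler_pXn2r// ?nnegrE ?mdist_ge0//.
  exact: step.
  exact: le_trans (mdist_ge0 _ _) (step _ _ l0 zl).
case: j => [|j].
  rewrite mul0r subr0 metric_sym.
  have := step mu i.+1 m0 zm; set A := mdist z _ => hA.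
  have : A ^+ 2 <= (L * (i.+1%:R * mu)) ^+ 2.
    by rewrite ler_pXn2r// nnegrE ?mdist_ge0// (le_trans _ hA)// mdist_ge0.
  have : 0 <= L ^+ 2 * (i.+1%:R * mu * (lambda - mu)).
    by rewrite mulr_ge0 ?sqr_ge0// mulr_ge0 ?subr_ge0// mulr_ge0// ltW.
  lra.
rewrite !iterS; set u := iter i _ z; set v := iter j _ z.
pose p := resolvent f lambda v.
have a0 : 0 < mu / lambda by rewrite divr_gt0.
have a1 : mu / lambda <= 1 by rewrite ler_pdivrMr// mul1r.
(* By the resolvent identity, the [mu]-resolvent of this [w] is [p], so both new iterates are
   [mu]-resolvents. *)
have [|w [pw wv cw _]] := geodesic_comparison p v (mu / lambda) hX; first by rewrite ltW.
have <- : resolvent f mu w = resolvent f lambda v.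
  by apply: resolvent_identity; rewrite ?m0.
have := resolvent_nonexpansive _ u w m0.
set A := mdist (resolvent _ _ _) _ => hA.
have hA2 : A ^+ 2 <= mdist u w ^+ 2 by rewrite ler_pXn2r// nnegrE mdist_ge0.
have a1' : 0 <= 1 - mu / lambda by rewrite subr_ge0.
have h1 := ler_wpM2l a1' (IH j.+1); have h2 := ler_wpM2l (ltW a0) (IH j).
have h3 : 0 <= mu / lambda * (1 - mu / lambda) * mdist p v ^+ 2.
  by rewrite mulr_ge0 ?sqr_ge0// mulr_ge0// ltW.
rewrite -/u -/v iterS -/v -/p in h1 h2.
apply: le_trans hA2 _; have := cw u => h4.
apply: le_trans (_ : (1 - mu / lambda) * mdist u p ^+ 2 + mu / lambda * mdist u v ^+ 2 <= _).
  lra.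
apply: le_trans (lerD h1 h2) _; rewrite le_eqVlt; apply/orP; left; apply/eqP.
rewrite -!natr1; field; exact: lt0r_neq0.
Qed.

(** [z] is the [mu]-resolvent of a point of the geodesic from [z] to [x]. This bounds the first step
    from [z] by [L * mu] with one [L] for all [mu <= nu]. *)
Lemma resolvent_of_resolvent nu mu x : 0 < mu <= nu ->
  mdist (resolvent f nu x) (resolvent f mu (resolvent f nu x))
    <= mdist x (resolvent f nu x) / nu * mu.
Proof.
move=> /andP[m0 mn]; set z := resolvent f nu x; have n0 : 0 < nu by exact: lt_le_trans mn.
have mn01 : 0 <= mu / nu <= 1.
  by rewrite ltW ?divr_gt0//= ler_pdivrMr// mul1r.
have [w [zw wx _ _]] := geodesic_comparison z x _ hX mn01.
rewrite -[X in mdist X _](resolvent_identity nu mu x w) ?m0//.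
apply: (le_trans (resolvent_nonexpansive _ w z m0)).
by rewrite metric_sym zw (metric_sym z x) mulrC mulrCA mulrC.
Qed.

(** * Convergence rate of the implicit Euler scheme *)

Lemma iter_resolvent_nonexpansive lambda k x y : 0 < lambda ->
  mdist (iter k (resolvent f lambda) x) (iter k (resolvent f lambda) y)
    <= mdist x y.
Proof.
move=> l0; elim: k => //= k IH.
exact: le_trans (resolvent_nonexpansive _ _ _ l0) IH.
Qed.

(** Starting both schemes at [z] instead of [x] costs [mdist x z] twice. Both run for total time
    [t], so the square of the time difference vanishes and [t * (t / j - t / i) <= t ^+ 2 / j]
    remains. *)
Lemma euler_scheme_dist nu t x i j : 0 < t -> 0 < nu -> (0 < j <= i)%N ->
  t / j%:R <= nu ->
  mdist (iter i (resolvent f (t / i%:R)) x) (iter j (resolvent f (t / j%:R)) x)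
  <= 2 * mdist x (resolvent f nu x)
     + mdist x (resolvent f nu x) / nu * t / Num.sqrt j%:R.
Proof.
move=> t0 n0 /andP[j0 ji] tj.
have j0R : 0 < j%:R :> R by rewrite ltr0n.
have i0R : 0 < i%:R :> R by rewrite ltr0n (leq_trans j0).
have tj0 : 0 < t / j%:R by rewrite divr_gt0.
have ti0 : 0 < t / i%:R by rewrite divr_gt0.
have tij : t / i%:R <= t / j%:R by rewrite ler_pM2l// lef_pV2// ?posrE// ler_nat.
set z := resolvent f nu x.
have := iter_resolvent_nonexpansive _ i x z ti0.
have := iter_resolvent_nonexpansive _ j z x tj0.
set xi := iter i _ x; set zi := iter i _ z.
set xj := iter j _ x; set zj := iter j _ z => hj hi.
have hz : mdist zi zj <= mdist x z / nu * t / Num.sqrt j%:R.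
  have C0 : 0 <= mdist x z / nu * t / Num.sqrt j%:R.
    by rewrite !mulr_ge0 ?mdist_ge0 ?invr_ge0 ?sqrtr_ge0// ltW.
  rewrite -(@ler_pXn2r _ 2)// ?nnegrE ?mdist_ge0//.
  apply: le_trans (iter_resolvent_dist (t / j%:R) _ (mdist x z / nu) _ i j _ _ _) _.
  - by rewrite ti0.
  - by apply: resolvent_of_resolvent; rewrite ti0 (le_trans tij).
  - by apply: resolvent_of_resolvent; rewrite tj0.
  rewrite ![_%:R * (t / _)]mulrC !divfK ?lt0r_neq0// subrr expr0n/= add0r.
  move: (mdist x z / nu) => L; rewrite [leRHS]exprMn exprVn (sqr_sqrtr (ltW j0R)).
  rewrite (exprMn 2 L t) -[leRHS]mulrA.
  rewrite ler_wpM2l ?sqr_ge0// expr2 -mulrA ler_pM2l//; lra.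
have := metric_triangle xi zi xj; have := metric_triangle zi zj xj.
rewrite (metric_sym z x) in hj; lra.
Qed.

(** Pass through a nearby [y] in the domain; nonexpansiveness reduces the claim to the displacement
    of [y], which the linear lower bound makes small. *)
Lemma resolvent_near_closure x e : closure (dom f) x -> 0 < e ->
  exists2 nu, 0 < nu & mdist x (resolvent f nu x) < e.
Proof.
move=> clx e0; have e30 : 0 < e / 3 by rewrite divr_gt0.
have [y [fy]] := clx _ (nbhsx_ballx x (e / 3) e30); rewrite ballEmdist/= => xy.
have [B B0 hB] := convex_lower_bound fy.
have K0 : 0 < 2 * ((e / 3)^-1 + B).
  by rewrite mulr_gt0// ltr_pwDl// invr_gt0.
(* Chosen so that [e / 3 <= D] would force [D <= e / 4]. *)
pose nu := e / 4 / (2 * ((e / 3)^-1 + B)).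
have n0 : 0 < nu by rewrite !divr_gt0.
exists nu => //.
have := resolvent_nonexpansive _ y x n0.
have := metric_triangle x y (resolvent f nu x).
have := metric_triangle y (resolvent f nu y) (resolvent f nu x).
set p := resolvent f nu y.
suff : mdist y p < e / 3 by rewrite (metric_sym y x); lra.
have [fp pmin] := resolvent_minimizer _ y n0.
rewrite -/p in fp pmin; have := pmin y fy; have := hB _ fp.
rewrite mdistxx expr0n/= mulr0 addr0; set D := mdist y p => h1 h2.
rewrite ltNge; apply/negP => eD.
have D0 : 0 < D by exact: lt_le_trans eD.
have h3 : (2 * nu)^-1 * D ^+ 2 <= 1 + B * D by lra.
have h4 : D ^+ 2 <= 2 * nu * (1 + B * D).
  by rewrite -ler_pdivrMl// mulr_gt0.
have h5 : 1 <= (e / 3)^-1 * D by rewrite ler_pdivlMl// mulr1.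
have h6 : D * D <= nu * (2 * ((e / 3)^-1 + B)) * D.
  rewrite -expr2; apply: le_trans h4 _.
  have -> : nu * (2 * ((e / 3)^-1 + B)) * D = 2 * nu * ((e / 3)^-1 * D + B * D) by ring.
  apply: ler_wpM2l; [by rewrite mulr_ge0 ?ltW | by rewrite lerD2r].
move: h6; rewrite ler_pM2r// /nu divfK ?lt0r_neq0//; lra.
Qed.

Lemma near_euler_error (C t nu e : R) : 0 < nu -> 0 < e ->
  \forall k \near \oo,
    [/\ (0 < k)%N, t / k%:R <= nu & C / Num.sqrt k%:R < e].
Proof.
move=> n0 e0; near=> k.
have k0 : (0 < k)%N by near: k; exact: nbhs_infty_gt.
have k0R : 0 < k%:R :> R by rewrite ltr0n.
split=> //.
  rewrite ler_pdivrMr// mulrC -ler_pdivrMr// ltW//.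
  by near: k; exact: nbhs_infty_gtr.
rewrite ltr_pdivrMr ?sqrtr_gt0// mulrC -ltr_pdivrMr//.
apply: le_lt_trans (ler_norm _) _; rewrite -sqrtr_sqr ltr_sqrt//.
by near: k; exact: nbhs_infty_gtr.
Unshelve. all: by end_near. Qed.

(** Choosing first [nu], then the number of steps, makes the scheme Cauchy; so [xget] returns a
    limit and not its default. *)
Lemma gradient_flow_cvg t x : closure (dom f) x -> 0 < t ->
  (fun k : nat => iter k (resolvent f (t / k%:R)) x) @ \oo --> gradient_flow f t x.
Proof.
move=> clx t0; rewrite /gradient_flow.
apply: (xgetPex x (P := [set l | _ --> l])).
apply: cauchy_seq_cvg => // e e0.
have e40 : 0 < e / 4 by rewrite divr_gt0.
have [nu n0 xn] := resolvent_near_closure x (e / 4) clx e40.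
have e20 : 0 < e / 2 by rewrite divr_gt0.
have [N _ hN] := near_euler_error (mdist x (resolvent f nu x) / nu * t) t nu (e / 2) n0 e20.
exists N => i j Ni ij; have [i0 tin si] := hN i Ni.
have := euler_scheme_dist nu t x j i t0 n0; rewrite i0 => /(_ ij tin).
rewrite metric_sym; lra.
Qed.

(** Let the finer scheme in [euler_scheme_dist] tend to its limit. *)
Lemma gradient_flow_dist nu t x k : closure (dom f) x -> 0 < t -> 0 < nu ->
  (0 < k)%N -> t / k%:R <= nu ->
  mdist (iter k (resolvent f (t / k%:R)) x) (gradient_flow f t x)
  <= 2 * mdist x (resolvent f nu x)
     + mdist x (resolvent f nu x) / nu * t / Num.sqrt k%:R.
Proof.
move=> clx t0 n0 k0 tk.
have Scvg := mdist_cvg (iter k (resolvent f (t / k%:R)) x) _ _ (gradient_flow_cvg t x clx t0).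
apply: (cvgr_to_le Scvg).
near=> i; rewrite metric_sym; apply: euler_scheme_dist => //.
by rewrite k0; near: i; exact: nbhs_infty_ge.
Unshelve. all: by end_near. Qed.

End resolvent_theory.

(** * Passage to the limit along the asymptotic relation *)

Lemma asym_cvg_iter_resolvent {R : realType} {H : metricType R}
  {Hn : nat -> metricType R} {tau : topology_on (dunion Hn H)}
  {f : H -> \bar R} {fn : forall n, Hn n -> \bar R} {lambda : R} :
  (forall x, dom f (resolvent f lambda x)) ->
  (forall (x : H) (u : forall n, Hn n), closure (dom f) x ->
    asym_cvg tau u x ->
    asym_cvg tau (fun n => resolvent (fn n) lambda (u n))
      (resolvent f lambda x)) ->
  forall k (x : H) (u : forall n, Hn n), closure (dom f) x ->
    asym_cvg tau u x ->
    asym_cvg tau (fun n => iter k (resolvent (fn n) lambda) (u n))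
      (iter k (resolvent f lambda) x).
Proof.
move=> domJ Jcvg; elim=> [|k IH] x u clx ux //; rewrite iterS.
apply: Jcvg; last exact: IH.
(* With no step the point is [x], in the closure; afterwards it is a resolvent, in the domain. *)
by case: k {IH} => [|k] //; rewrite iterS; apply: subset_closure.
Qed.

Theorem theorem4p6 (R : realType) (H : metricType R) (Hn : nat -> metricType R)
  (hadH : hadamard_space H) (hadHn : forall n, hadamard_space (Hn n))
  (tau : topology_on (dunion Hn H)) (asym : asymptotic_relation tau)
  (f : H -> \bar R) (fn : forall n, Hn n -> \bar R)
  (f_gtNy : forall x, (-oo < f x)%E)
  (f_proper : proper_fun f)
  (f_lsc : lower_semicontinuous f)
  (f_convex : geodesically_convex f)
  (fn_gtNy : forall n x, (-oo < fn n x)%E)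
  (fn_proper : forall n, proper_fun (fn n))
  (fn_lsc : forall n, lower_semicontinuous (fn n))
  (fn_convex : forall n, geodesically_convex (fn n))
  (resolvent_cvg : forall (x : H) (u : forall n, Hn n) (lambda : R),
    closure (dom f) x -> asym_cvg tau u x -> 0 < lambda ->
    asym_cvg tau (fun n => resolvent (fn n) lambda (u n))
      (resolvent f lambda x)) :
  forall (x : H) (u : forall n, Hn n) (t : R),
    closure (dom f) x -> (forall n, closure (dom (fn n)) (u n)) ->
    asym_cvg tau u x -> 0 < t ->
    asym_cvg tau (fun n => gradient_flow (fn n) t (u n)) (gradient_flow f t x).
Proof.
move=> x u t clx clu ux t0.
(* It suffices that the flows of [u n] approach some sequence [s] converging to the limit flow. *)
have [s s_cvg] := asym_approx asym (gradient_flow f t x).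
apply: (asym_near asym s_cvg); apply/cvgrPdist_lt => e e0.
have e80 : 0 < e / 8 by rewrite divr_gt0.
have [nu n0 xn] := resolvent_near_closure hadH f_gtNy f_proper f_lsc f_convex x
  (e / 8) clx e80.
pose C := e / 8 / nu * t.
have [k [k0 tk Ck]] : exists k : nat,
    [/\ (0 < k)%N, t / k%:R <= nu & C / Num.sqrt k%:R < e / 8].
  by have [N _ hN] := near_euler_error C t nu (e / 8) n0 e80; exists N; apply: hN => /=.
have tk0 : 0 < t / k%:R by rewrite divr_gt0// ltr0n.
(* If the resolvent of parameter [nu] moves [y] by less than [e / 8], then [k]
   implicit Euler steps from [y] are [3 * (e / 8)]-close to the flow. *)
have err (d : R) : 0 <= d -> d < e / 8 ->
    2 * d + d / nu * t / Num.sqrt k%:R < 3 * (e / 8).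
  move=> d0 de; suff : d / nu * t / Num.sqrt k%:R <= C / Num.sqrt k%:R by lra.
  by rewrite /C !ler_wpM2r ?invr_ge0 ?sqrtr_ge0 ?(ltW n0) ?(ltW t0) ?(ltW de).
have iter_cvg := asym_cvg_iter_resolvent
  (fun y => dom_resolvent hadH f_gtNy f_proper f_lsc f_convex _ y tk0)
  (fun y v cly vy => resolvent_cvg y v _ cly vy tk0) k x u clx ux.
(* Distances converge along the relation, so strict bounds at the limit hold for large [n]. *)
have dist_s := asym_dist asym s_cvg iter_cvg.
have dist_u := asym_dist asym ux (resolvent_cvg x u nu clx ux n0).
have flow_x := gradient_flow_dist hadH f_gtNy f_proper f_lsc f_convex nu t x k clx t0 n0 k0 tk.
have lt_x := le_lt_trans flow_x (err _ (mdist_ge0 _ _) xn).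
rewrite metric_sym in lt_x.
near=> n.
have un : mdist (u n) (resolvent (fn n) nu (u n)) < e / 8.
  by near: n; apply: (cvgr_lt _ dist_u).
have sn : mdist (s n) (iter k (resolvent (fn n) (t / k%:R)) (u n)) < 3 * (e / 8).
  by near: n; apply: (cvgr_lt _ dist_s).
have flow_n := gradient_flow_dist (hadHn n) (fn_gtNy n) (fn_proper n) (fn_lsc n)
  (fn_convex n) nu t (u n) k (clu n) t0 n0 k0 tk.
have lt_n := le_lt_trans flow_n (err _ (mdist_ge0 _ _) un).
rewrite sub0r normrN ger0_norm ?mdist_ge0//.
apply: le_lt_trans (metric_triangle _ (iter k (resolvent (fn n) (t / k%:R)) (u n)) _) _.
lra.
Unshelve. all: by end_near. Qed.
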